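(* Let $G$ be a (discrete) quasihamiltonian torsion FC-group, let $\phi : G\to G$ be an endomorphism, let $H$ be a normal subgroup of $G$ with $\phi(H)\leq H$, and let $\bar\phi : G/H\to G/H$ be the induced map. Then $$h_{alg}(\phi)=h_{alg}(\bar\phi)+h_{alg}(\phi\restriction_H).$$
   Context: A group $G$ is quasihamiltonian if $XY=YX$ for every pair of subgroups $X,Y$ of $G$. A group is torsion if all its elements have finite order, and an FC-group if every element has only finitely many conjugates. Algebraic entropy of a discrete group (the discrete case, with counting measure, of the general definition for locally compact groups): for an endomorphism $\phi$ of $G$, $U\subseteq G$ and $n\geq 1$ put $T_n(\phi,U)=U\cdot\phi(U)\cdots\phi^{n-1}(U)$. For a finite subset $U$ of $G$ containing $e_G$ put $H_{alg}(\phi,U)=\limsup_{n\to\infty}\frac{\log|T_n(\phi,U)|}{n}$, and let $h_{alg}(\phi)\in[0,\infty]$ be the supremum of $H_{alg}(\phi,U)$ over all such $U$. The entropies of $\phi\restriction_H: H\to H$ and $\bar\phi: G/H\to G/H$, $\bar\phi(gH)=\phi(g)H$, are computed in $H$ and $G/H$. *)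

(* Defs.v *)
From HB Require Import structures.
From mathcomp Require Import all_boot all_order all_algebra finmap.
From mathcomp Require Import all_classical all_reals all_analysis.

Set Implicit Arguments.
Unset Strict Implicit.
Unset Printing Implicit Defensive.

Import Order.TTheory GRing.Theory Num.Theory.
Local Open Scope classical_set_scope.
Local Open Scope group_scope.

(* [groupType] is the type of arbitrary (possibly infinite) groups and
   [groupClosed G] the type of subgroups of [G], as boolean predicates; under
   the classical axioms these are all the subgroups.  Endomorphisms are
   [UMagmaMorphism.type G G]: maps preserving product and unit. *)

Section GroupConditions.
Variable G : groupType.

Definition set_mul (A B : set G) : set G := [set x * y | x in A & y in B].

Definition quasihamiltonian : Prop :=
  forall X Y : groupClosed G,
    set_mul [set` X] [set` Y] = set_mul [set` Y] [set` X].

Definition torsion : Prop := forall x : G, exists2 n, (0 < n)%N & x ^+ n = 1.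

Definition FC_group : Prop :=
  forall x : G, finite_set [set x ^ g | g in [set: G]].

Definition normal_subgroup (H : groupClosed G) : Prop :=
  forall x g : G, x \in H -> x ^ g \in H.

Definition stable_subgroup (phi : G -> G) (H : groupClosed G) : Prop :=
  forall x : G, x \in H -> phi x \in H.

End GroupConditions.

Section AlgebraicEntropy.
Variables (R : realType) (G : groupType).
Implicit Types (phi : UMagmaMorphism.type G G) (U : set G).

Definition trajectory phi U (n : nat) : set G :=
  \big[@set_mul G/[set 1]]_(i < n) (iter i phi @` U).

(* The value of the sequence at [n = 0] is irrelevant to the limsup. *)
Definition H_alg phi U : \bar R :=
  limn_esup (fun n =>
    (ln (#|` fset_set (trajectory phi U n)|%:R : R) / n%:R)%R%:E).

Definition h_alg phi : \bar R :=
  ereal_sup [set H_alg phi U | U in [set U | finite_set U /\ U 1]].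

End AlgebraicEntropy.

Section Subgroup.
Variables (G : groupType) (H : groupClosed G).

Definition subgroup_type : Type := {x : G | x \in H}.

HB.instance Definition _ := SubChoice.on subgroup_type.

Lemma subgroup_closed : group_closed (fun x : G => x \in H).
Proof. by split=> [|x y]; [exact: gpred1 | exact: gpredF]. Qed.

HB.instance Definition _ :=
  SubChoice_isSubGroup.Build G _ subgroup_type subgroup_closed.

Variables (phi : UMagmaMorphism.type G G) (sH : stable_subgroup phi H).

Definition restr_endo (x : subgroup_type) : subgroup_type :=
  Sub (phi (val x)) (sH (valP x)).

Lemma restr_endo_morph : monoid.monoid_morphism restr_endo.
Proof.
split=> [|x y]; apply: val_inj; first exact: gmulf1.
by rewrite [RHS]valM /= gmulfM.
Qed.

HB.instance Definition _ :=
  isUMagmaMorphism.Build subgroup_type subgroup_type restr_endo restr_endo_morph.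

End Subgroup.

Section Quotient.
Local Open Scope quotient_scope.
Variables (G : groupType) (H : groupClosed G).

(* [lcoset_rel x y] iff xH = yH *)
Definition lcoset_rel : rel G := fun x y => x^-1 * y \in H.

Lemma lcoset_rel_equiv : equiv_class_of lcoset_rel.
Proof.
rewrite /lcoset_rel; split=> [x|x y|y x z]; first by rewrite mulVg gpred1.
  by rewrite -gpredV invgM invgK.
have -> : x^-1 * z = (x^-1 * y) * (y^-1 * z) by rewrite -mulgA mulVKg.
exact: gpredM.
Qed.

Canonical lcoset_equiv := EquivRelPack lcoset_rel_equiv.

Variable nH : normal_subgroup H.

Definition quotient_group of normal_subgroup H : Type := {eq_quot lcoset_equiv}.
Local Notation Q := (quotient_group nH).

HB.instance Definition _ := Choice.on Q.
HB.instance Definition _ := EqQuotient.on Q.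

Definition quot_mul (u v : Q) : Q := \pi_Q (repr u * repr v).
Definition quot_one : Q := \pi_Q 1.
Definition quot_inv (u : Q) : Q := \pi_Q (repr u)^-1.

Lemma quotP x y : reflect (\pi_Q x = \pi_Q y) (x^-1 * y \in H).
Proof. exact: (eqquotP Q x y). Qed.

Lemma repr_pi x : x^-1 * repr (\pi_Q x) \in H.
Proof. by apply/quotP; rewrite reprK. Qed.

Lemma quot_mulE x y : quot_mul (\pi_Q x) (\pi_Q y) = \pi_Q (x * y).
Proof.
apply/esym/quotP; set a := repr _; set b := repr _.
have -> : (x * y)^-1 * (a * b) = (x^-1 * a) ^ y * (y^-1 * b).
  by rewrite conjgE invgM -!mulgA mulVKg.
by rewrite gpredM ?nH ?repr_pi.
Qed.

Lemma quot_invE x : quot_inv (\pi_Q x) = \pi_Q x^-1.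
Proof.
apply/quotP; rewrite invgK; set a := repr _.
have -> : a * x^-1 = (x^-1 * a) ^ x^-1 by rewrite conjgE invgK mulgA mulVKg.
by rewrite nH ?repr_pi.
Qed.

Lemma quot_mulA : associative quot_mul.
Proof.
elim/quotW=> x; elim/quotW=> y; elim/quotW=> z.
by rewrite (quot_mulE y) (quot_mulE x y) !quot_mulE mulgA.
Qed.
Lemma quot_mul1 : left_id quot_one quot_mul.
Proof. by elim/quotW=> x; rewrite quot_mulE mul1g. Qed.
Lemma quot_1mul : right_id quot_one quot_mul.
Proof. by elim/quotW=> x; rewrite quot_mulE mulg1. Qed.
Lemma quot_mulV : left_inverse quot_one quot_inv quot_mul.
Proof. by elim/quotW=> x; rewrite quot_invE quot_mulE mulVg. Qed.
Lemma quot_Vmul : right_inverse quot_one quot_inv quot_mul.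
Proof. by elim/quotW=> x; rewrite quot_invE quot_mulE mulgV. Qed.

HB.instance Definition _ := isGroup.Build Q
  quot_mulA quot_mul1 quot_1mul quot_mulV quot_Vmul.

Variables (phi : UMagmaMorphism.type G G) (sH : stable_subgroup phi H).

Definition quot_endo of stable_subgroup phi H : Q -> Q :=
  fun u => \pi_Q (phi (repr u)).

Lemma quot_endoE x : quot_endo sH (\pi_Q x) = \pi_Q (phi x).
Proof. by apply/esym/quotP; rewrite -gmulfV -gmulfM sH ?repr_pi. Qed.

Lemma quot_endo_morph : monoid.monoid_morphism (quot_endo sH).
Proof.
split=> [|u v]; first by rewrite quot_endoE gmulf1.
elim/quotW: u => x; elim/quotW: v => y.
rewrite [LHS](congr1 (quot_endo sH) (quot_mulE x y)) !quot_endoE gmulfM.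
by rewrite [RHS]quot_mulE.
Qed.

HB.instance Definition _ :=
  isUMagmaMorphism.Build Q Q (quot_endo sH) quot_endo_morph.

End Quotient.

Arguments quot_endo {G H} nH {phi} sH u.

(* Main.v *)
Require Import Defs.
From HB Require Import structures.
From mathcomp Require Import all_boot all_order all_algebra finmap.
From mathcomp Require Import all_classical all_reals all_analysis.

(** In a torsion group whose subgroups permute, a product of finitely many
    finite cyclic subgroups is a finite subgroup; so every finite set lies in a
    finite subgroup ([locally_finite]) and the entropy may be computed on finite
    subgroups [F].  For such [F] each trajectory [T_n = F phi(F) ...
    phi^(n-1)(F)] is again a finite subgroup, being a product of permuting
    subgroups, although no [phi^k(F)] has to be normal.

    The index of [T_n] in [T_(n+1)] does not increase with [n], since [phi]
    induces a surjection from the coset space [T_(n+1) / T_n] to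
    [T_(n+2) / T_(n+1)].  It is therefore equal to some [t] for all large [n] ([trajectory_stable]), which
    has two consequences:
    - [log |T_n| / n] converges, to [log t], and limits, unlike upper limits,
      can be added ([H_alg_growth]);
    - for large [n] these surjections are bijections: if [x] in [T_(n+1)] has
      [phi x] in [T_(n+1)], then [x] lies in [T_n].

    Let [p : G -> G/H] be the projection.  Lagrange's theorem gives
    [|T_n(F)| = |T_n(p F)| |T_n(F) :&: H|], and both inequalities come from
    comparing the last factor with trajectories inside [H].
    - For [>=], given finite subgroups [E] of [G/H] and [L] of [H], take a
      finite subgroup [F] containing [L] and a lift of [E]: then
      [T_n(L)] is contained in [T_n(F) :&: H] ([H_alg_add_le_h_alg]).
    - For [<=], a single finite subgroup [L] of [H] has
      [T_n(F) :&: H] contained in [T_n(L)] for all [n] ([trajectory_kernel]).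
      One takes [L = T_(N+1)(F) :&: H], where [N] is the rank from which the
      trajectory of [p F] in [G/H] is stable.

    The argument is carried out for an arbitrary exact sequence of groups with
    endomorphisms, [S -> G -> Q] ([h_alg_extension]). *)

Set Implicit Arguments.
Unset Strict Implicit.
Unset Printing Implicit Defensive.

Import Order.TTheory GRing.Theory Num.Theory.
Import numFieldNormedType.Exports.
Local Open Scope classical_set_scope.
Local Open Scope group_scope.

Local Notation card A := #|` fset_set A|.

(** * Cardinals of finite sets *)

Lemma card_subset (T : choiceType) (A B : set T) :
  finite_set B -> A `<=` B -> (card A <= card B)%N.
Proof.
move=> fB AB; apply: fsubset_leq_card; rewrite -fset_set_sub //.
exact: sub_finite_set AB fB.
Qed.

Lemma card_subset_eq (T : choiceType) (A B : set T) :
  finite_set B -> A `<=` B -> card A = card B -> A = B.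
Proof.
move=> fB AB cAB; have fA := sub_finite_set AB fB.
apply: fset_set_inj => //; apply/eqP; rewrite eqEfcard cAB leqnn andbT.
by rewrite -fset_set_sub.
Qed.

Lemma card_injective_image (T U : choiceType) (f : T -> U) (A : set T) :
  injective f -> finite_set A -> card (f @` A) = card A.
Proof. by move=> fI fA; rewrite fset_set_image// card_imfset. Qed.

Lemma card_gt0 (T : choiceType) (A : set T) x :
  finite_set A -> A x -> (0 < card A)%N.
Proof.
move=> fA Ax; rewrite cardfs_gt0; apply/eqP => A0.
by have := in_fset_set fA x; rewrite A0 inE mem_set.
Qed.

(** * Permuting subgroups and local finiteness *)

Section Subgroups.
Variable G : groupType.
Implicit Types A B C : set G.

Lemma set_mulA : associative (@set_mul G).
Proof.
move=> A B C; apply/seteqP; split=> x.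
  by case=> a Aa [_ [b Bb [c Cc <-]] <-]; exists (a * b);
    [exists a => //; exists b|exists c => //; rewrite mulgA].
by case=> _ [a Aa [b Bb <-]] [c Cc <-]; exists a => //; exists (b * c);
  [exists b => //; exists c|rewrite mulgA].
Qed.

Lemma set_mul1g : left_id [set 1] (@set_mul G).
Proof.
move=> A; apply/seteqP; split=> x; first by case=> _ -> [a Aa <-]; rewrite mul1g.
by move=> Ax; exists 1 => //; exists x => //; rewrite mul1g.
Qed.

Lemma set_mulg1 : right_id [set 1] (@set_mul G).
Proof.
move=> A; apply/seteqP; split=> x; first by case=> a Aa [_ -> <-]; rewrite mulg1.
by move=> Ax; exists x => //; exists 1 => //; rewrite mulg1.
Qed.

HB.instance Definition _ := Monoid.isLaw.Build (set G) [set 1] (@set_mul G)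
  set_mulA set_mul1g set_mulg1.

Lemma set_mulS A A' B B' :
  A `<=` A' -> B `<=` B' -> set_mul A B `<=` set_mul A' B'.
Proof.
by move=> AA BB _ [a Aa [b Bb <-]]; exists a; [exact: AA|exists b => //; exact: BB].
Qed.

Lemma finite_set_mul A B : finite_set A -> finite_set B -> finite_set (set_mul A B).
Proof. exact: finite_image2. Qed.

Definition is_subgroup A := A 1 /\ forall x y, A x -> A y -> A (x^-1 * y).

Lemma is_subgroupV A x : is_subgroup A -> A x -> A x^-1.
Proof. by case=> A1 AD Ax; have := AD _ _ Ax A1; rewrite mulg1. Qed.

Lemma is_subgroupM A x y : is_subgroup A -> A x -> A y -> A (x * y).
Proof.
by move=> sA /(is_subgroupV sA) Ax Ay; have := sA.2 _ _ Ax Ay; rewrite invgK.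
Qed.

Lemma is_subgroupI A B : is_subgroup A -> is_subgroup B -> is_subgroup (A `&` B).
Proof.
move=> [A1 AD] [B1 BD]; split=> // x y [Ax Bx] [Ay By].
by split; [exact: AD|exact: BD].
Qed.

Lemma is_subgroupP A : is_subgroup A -> exists K : groupClosed G, [set` K] = A.
Proof.
move=> sA; pose p : {pred G} := [pred x | x \in A].
have pM : mulg_closed p.
  by move=> x y; rewrite !inE; exact: is_subgroupM.
have p1 : 1 \in p by rewrite !inE; exact: sA.1.
have pV : invg_closed p by move=> x; rewrite !inE; exact: is_subgroupV.
pose m1 := isMulClosed.Build G p pM.
pose m2 := isMul1Closed.Build G p p1.
pose m3 := isInvClosed.Build G p pV.
pose K : groupClosed G := HB.pack p m1 m2 m3.
by exists K; apply/seteqP; split=> x /=; rewrite !inE.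
Qed.

(** Quasihamiltonian groups again, with subgroups given as sets; images and
    preimages under morphisms are then available as subgroups. *)
Definition permutable :=
  forall A B, is_subgroup A -> is_subgroup B -> set_mul A B = set_mul B A.

Lemma quasihamiltonian_permutable : quasihamiltonian G -> permutable.
Proof.
by move=> hQ A B /is_subgroupP[X <-] /is_subgroupP[Y <-]; exact: hQ.
Qed.

Lemma is_subgroup_mul A B : is_subgroup A -> is_subgroup B ->
  set_mul A B = set_mul B A -> is_subgroup (set_mul A B).
Proof.
move=> sA sB AB; split.
  by exists 1; [exact: sA.1|exists 1; [exact: sB.1|rewrite mulg1]].
move=> _ _ [a Aa [b Bb <-]] [c Ac [d Bd <-]].
have : set_mul A B (b^-1 * (a^-1 * c)).
  rewrite AB; exists b^-1; first exact: is_subgroupV.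
  by exists (a^-1 * c) => //; exact: sA.2.
case=> e Ae [f Bf E]; exists e => //; exists (f * d).
  exact: is_subgroupM.
by rewrite mulgA E invgM !mulgA.
Qed.

Hypothesis perm_G : permutable.

Lemma finite_cyclic (x : G) : torsion G ->
  exists A, [/\ finite_set A, is_subgroup A & A x].
Proof.
move=> /(_ x)[n n0 xn].
have xV k : x ^- k = x ^+ (n * k - k).
  apply: (mulgI (x ^+ k)); rewrite mulgV -expgnDr subnKC; last by rewrite leq_pmull.
  by rewrite expgnA xn expg1n.
have xmod k : x ^+ k = x ^+ (k %% n).
  by rewrite {1}(divn_eq k n) expgnDr mulnC expgnA xn expg1n mul1g.
exists [set x ^+ k | k in [set: nat]]; split.
- apply: (@sub_finite_set _ _ [set x ^+ k | k in `I_n]).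
    by move=> _ [k _ <-]; exists (k %% n)%N; rewrite -?xmod /= ?ltn_mod.
  exact/finite_image/finite_II.
- split; first by exists 0%N.
  by move=> _ _ [j _ <-] [k _ <-]; rewrite xV -expgnDr; eexists.
- by exists 1%N.
Qed.

(** Finitely many elements generate a subgroup of the product of the cyclic
    groups they span, and that product is a group because these commute as
    sets. *)
Lemma locally_finite (U : set G) : torsion G -> finite_set U ->
  exists A, [/\ finite_set A, is_subgroup A & U `<=` A].
Proof.
move=> tG /finite_seqP[s ->]; elim: s => [|x s [A [fA sA sU]]].
  exists [set 1]; split=> //; by split=> // x y -> ->; rewrite mulVg.
have [B [fB sB Bx]] := finite_cyclic x tG.
exists (set_mul B A); split; first exact: finite_set_mul.
  by apply: is_subgroup_mul => //; exact: perm_G.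
move=> y /=; rewrite inE => /predU1P[->|ys].
  by exists x => //; exists 1; [exact: sA.1|rewrite mulg1].
by exists 1; [exact: sB.1|exists y; [exact: sU|rewrite mul1g]].
Qed.

End Subgroups.

(** * Lagrange's theorem *)

Section Lagrange.
Variables (G : groupType) (X : choiceType).

(** The fibers of [f] on [A] are the translates of [A `&` K].  Taking for [f]
    either a map to cosets or a morphism gives Lagrange's theorem without
    forming quotients. *)
Lemma card_fibers (f : G -> X) (A K : set G) :
  finite_set A -> is_subgroup A ->
  (forall x y, A x -> A y -> f x = f y <-> K (x^-1 * y)) ->
  card A = (card (f @` A) * card (A `&` K))%N.
Proof.
move=> fA sA fK; rewrite card_fset_sum1 (partition_big_imfset _ f) /=.
rewrite fset_set_image// mulnC.
rewrite (eq_big_seq (fun=> card (A `&` K))).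
  by rewrite big_const_seq iter_addn_0 count_predT.
move=> _ /imfsetP[a /= aA ->]; rewrite big_fset_condE -card_fset_sum1.
have Aa : A a by move: aA; rewrite in_fset_set// inE.
have fAK : finite_set (A `&` K) by exact: sub_finite_set fA.
rewrite -(card_injective_image (mulgI a)) //; congr (#|` _|).
apply/fsetP => x; rewrite !inE /= !in_fset_set//; last exact: finite_image.
apply/andP/idP; rewrite !inE.
  case=> Ax /eqP /esym fax; exists (a^-1 * x); last by rewrite mulVKg.
  by split; [exact: sA.2|apply/fK].
case=> b [Ab Kb] <-; have Aab : A (a * b) by exact: is_subgroupM.
by split => //; apply/eqP/esym/fK => //; rewrite mulKg.
Qed.

End Lagrange.

(** * Transport along morphisms *)

Section Morphisms.
Variables (G K : groupType) (f : UMagmaMorphism.type G K).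

Lemma image_set_mul (A B : set G) :
  f @` set_mul A B = set_mul (f @` A) (f @` B).
Proof.
apply/seteqP; split=> [_ [_ [a Aa [b Bb <-]] <-]|_ [_ [a Aa <-] [_ [b Bb <-] <-]]].
  by exists (f a); [exists a|exists (f b); [exists b|rewrite gmulfM]].
by exists (a * b); [exists a => //; exists b|rewrite gmulfM].
Qed.

Lemma is_subgroup_image (A : set G) : is_subgroup A -> is_subgroup (f @` A).
Proof.
move=> [A1 AD]; split; first by exists 1; rewrite ?gmulf1.
move=> _ _ [a Aa <-] [b Ab <-]; exists (a^-1 * b); first exact: AD.
by rewrite gmulfM gmulfV.
Qed.

Lemma is_subgroup_preimage (A : set K) : is_subgroup A -> is_subgroup (f @^-1` A).
Proof.
move=> [A1 AD]; split; first by rewrite /= gmulf1.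
by move=> a b /= Aa Ab; rewrite gmulfM gmulfV; exact: AD.
Qed.

Lemma permutable_surjective :
  (forall y, exists x, f x = y) -> permutable G -> permutable K.
Proof.
move=> fS pG A B sA sB.
have fK (C : set K) : f @` (f @^-1` C) = C.
  by apply/image_preimage/seteqP; split=> // y _; have [x <-] := fS y; exists x.
by rewrite -(fK A) -(fK B) -!image_set_mul (pG _ _ (is_subgroup_preimage sA)
  (is_subgroup_preimage sB)).
Qed.

Lemma permutable_injective : injective f -> permutable K -> permutable G.
Proof.
move=> fI pK A B sA sB.
have E : f @` set_mul A B = f @` set_mul B A.
  by rewrite !image_set_mul; apply: pK; exact: is_subgroup_image.
apply/seteqP; split=> x xAB.
  have [y yBA /fI <-//] : (f @` set_mul B A) (f x) by rewrite -E; exists x.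
have [y yBA /fI <-//] : (f @` set_mul A B) (f x) by rewrite E; exists x.
Qed.

Lemma torsion_surjective : (forall y, exists x, f x = y) -> torsion G -> torsion K.
Proof.
move=> fS tG y; have [x <-] := fS y; have [n n0 xn] := tG x.
by exists n => //; rewrite -gmulfXn xn gmulf1.
Qed.

Lemma torsion_injective : injective f -> torsion K -> torsion G.
Proof.
move=> fI tK x; have [n n0 xn] := tK (f x).
by exists n => //; apply: fI; rewrite gmulfXn xn gmulf1.
Qed.

End Morphisms.

(** * Trajectories *)

Section Trajectories.
Variables (G : groupType) (phi : UMagmaMorphism.type G G).
Implicit Types U V F : set G.

Lemma trajectory0 U : trajectory phi U 0 = [set 1].
Proof. by rewrite /trajectory big_ord0. Qed.

Lemma trajectorySr U n :
  trajectory phi U n.+1 = set_mul (trajectory phi U n) (iter n phi @` U).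
Proof. by rewrite /trajectory big_ord_recr. Qed.

(** The recursion at the left end, [T_(n+1) = U phi(T_n)]: it presents the
    trajectory in terms of [phi] alone, whereas [trajectorySr] involves its
    iterates. *)
Lemma trajectoryS U n :
  trajectory phi U n.+1 = set_mul U (phi @` trajectory phi U n).
Proof.
elim: n => [|n IH].
  rewrite trajectorySr !trajectory0 image_set1 gmulf1 set_mul1g set_mulg1.
  exact: image_id.
rewrite trajectorySr {1}IH -set_mulA (trajectorySr U n) image_set_mul.
by rewrite image_comp.
Qed.

Lemma trajectory_mono U V n :
  U `<=` V -> trajectory phi U n `<=` trajectory phi V n.
Proof.
move=> UV; elim: n => [|n IH]; first by rewrite !trajectory0.
by rewrite !trajectorySr; apply: set_mulS => //; exact: image_subset.
Qed.

Lemma finite_trajectory U n : finite_set U -> finite_set (trajectory phi U n).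
Proof.
move=> fU; elim: n => [|n IH]; first by rewrite trajectory0; exact: finite_set1.
by rewrite trajectorySr; apply: finite_set_mul => //; exact: finite_image.
Qed.

Lemma iter_morph1 n : iter n phi 1 = 1.
Proof. by elim: n => //= n ->; rewrite gmulf1. Qed.

Lemma iter_morphM n x y : iter n phi (x * y) = iter n phi x * iter n phi y.
Proof. by elim: n => //= n ->; rewrite gmulfM. Qed.

Lemma trajectory1 U n : U 1 -> trajectory phi U n 1.
Proof.
move=> U1; elim: n => [|n IH]; first by rewrite trajectory0.
rewrite trajectorySr; exists 1 => //; exists 1; last by rewrite mulg1.
by exists 1; rewrite ?iter_morph1.
Qed.

Lemma trajectory_leS U n : U 1 -> trajectory phi U n `<=` trajectory phi U n.+1.
Proof.
move=> U1 x Tx; rewrite trajectorySr; exists x => //; exists 1.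
  by exists 1; rewrite ?iter_morph1.
by rewrite mulg1.
Qed.

Lemma trajectory_le U m n : U 1 -> (m <= n)%N ->
  trajectory phi U m `<=` trajectory phi U n.
Proof.
move=> U1 /subnKC <-; elim: (n - m)%N => [|k IH]; first by rewrite addn0.
by rewrite addnS => x /IH; exact: trajectory_leS.
Qed.

Lemma trajectory_ge U n : U 1 -> U `<=` trajectory phi U n.+1.
Proof.
move=> U1 x Ux; rewrite trajectoryS; exists x => //; exists 1.
  by exists 1; [exact: trajectory1|rewrite gmulf1].
by rewrite mulg1.
Qed.

Lemma iter_trajectory U m n x : U 1 ->
  trajectory phi U n x -> trajectory phi U (m + n) (iter m phi x).
Proof.
move=> U1 Tx; elim: m => //= m IH; rewrite addSn trajectoryS.
by exists 1 => //; exists (phi (iter m phi x)); [exists (iter m phi x)|rewrite mul1g].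
Qed.

Hypothesis pG : permutable G.

Lemma is_subgroup_trajectory F n : is_subgroup F ->
  is_subgroup (trajectory phi F n).
Proof.
move=> sF; elim: n => [|n IH].
  by rewrite trajectory0; split=> // x y -> ->; rewrite mulVg.
have sT := is_subgroup_image phi IH.
by rewrite trajectoryS; apply: is_subgroup_mul => //; exact: pG.
Qed.

End Trajectories.

Lemma trajectory_image (G K : groupType) (f : UMagmaMorphism.type G K)
    (phi : UMagmaMorphism.type G G) (psi : UMagmaMorphism.type K K)
    (U : set G) n : (forall x, f (phi x) = psi (f x)) ->
  f @` trajectory phi U n = trajectory psi (f @` U) n.
Proof.
move=> fphi; elim: n => [|n IH]; first by rewrite !trajectory0 image_set1 gmulf1.
rewrite !trajectoryS image_set_mul -IH; congr (set_mul _ _).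
by rewrite !image_comp; apply: eq_imagel => x _ /=.
Qed.

Lemma nonincreasing_nat_stable (u : nat -> nat) :
  (forall n, (u n.+1 <= u n)%N) -> exists N, forall n, (N <= n)%N -> u n = u N.
Proof.
move=> du; pose P k := `[< exists n, u n = k >].
have exP : exists k, P k by exists (u 0); apply/asboolP; exists 0%N.
case: (ex_minnP exP) => m /asboolP[N uN] minm; exists N => n Nn.
apply/eqP; rewrite eqn_leq; apply/andP; split; last first.
  by rewrite uN; apply: minm; apply/asboolP; exists n.
elim: n Nn => [|n IH]; first by rewrite leqn0 => /eqP ->.
by rewrite leq_eqVlt => /predU1P[->//|/IH]; exact: leq_trans.
Qed.

(** * Stabilization of the indices of a trajectory *)

Section Stabilization.
Variables (G : groupType) (phi : UMagmaMorphism.type G G).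
Hypothesis pG : permutable G.
Variable F : set G.
Hypotheses (fF : finite_set F) (sF : is_subgroup F).

Local Notation T n := (trajectory phi F n).

Let left_coset n (x : G) : set G := [set y | T n (x^-1 * y)].

Let left_cosetP n x y : left_coset n x = left_coset n y <-> T n (x^-1 * y).
Proof.
have sT := is_subgroup_trajectory phi pG n sF; split.
  move=> E; have : left_coset n y y by rewrite /left_coset /= mulVg; exact: sT.1.
  by rewrite -E.
move=> xy; apply/seteqP; split=> z; rewrite /left_coset /= => h.
  by have := sT.2 _ _ xy h; rewrite invgM invgK -mulgA mulVKg.
by have := is_subgroupM sT xy h; rewrite -mulgA mulVKg.
Qed.

Let index n := card (left_coset n @` T n.+1).

Let cardTS n : card (T n.+1) = (index n * card (T n))%N.
Proof.
have sT := is_subgroup_trajectory phi pG n.+1 sF.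
rewrite (@card_fibers _ _ (left_coset n) _ (T n)) //; first last.
  exact: finite_trajectory.
congr (_ * card _)%N; apply/setIidPr; apply: trajectory_leS; exact: sF.1.
Qed.

(* The cosets of [T n] in [P n] are those that the map induced by [phi], from
   the cosets of [T n] in [T n.+1] to those of [T n.+1] in [T n.+2], sends to
   the trivial coset. *)
Let P n := T n.+1 `&` phi @^-1` T n.+1.

(* Lagrange for the map [x |-> phi x T_(n+1)] on [T_(n+1)]: it reaches all
   cosets in [T_(n+2)], since [T_(n+2) = phi(T_(n+1)) F] by permutability and
   [F] is absorbed by [T_(n+1)]. *)
Let cardTS_preimage n : card (T n.+1) = (index n.+1 * card (P n))%N.
Proof.
have sT := is_subgroup_trajectory phi pG n.+1 sF.
rewrite (@card_fibers _ _ (left_coset n.+1 \o phi) _ (phi @^-1` T n.+1)) //; first last.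
- by move=> x y _ _; rewrite /= gmulfM gmulfV; exact: left_cosetP.
- exact: finite_trajectory.
congr (card _ * _)%N; rewrite [T n.+2]trajectoryS.
rewrite pG //; last exact: is_subgroup_image.
apply/seteqP; split=> [_ [x Tx <-]|_ [_ [_ [x Tx <-] [u Fu <-]] <-]].
  exists (phi x) => //; exists (phi x); first by exists x.
  by exists 1; [exact: sF.1|rewrite mulg1].
exists x => //=; apply/left_cosetP; rewrite mulKg.
by apply: trajectory_ge => //; exact: sF.1.
Qed.

(** Comparing [|T_(n+1)| = index n |T_n|] with
    [|T_(n+1)| = index (n+1) |P_n|], where [P_n] contains [T_n], shows that the
    indices do not increase; once they are constant, [P_n = T_n]. *)
Lemma trajectory_stable : exists N t, [/\ (0 < t)%N,
  forall n, (N <= n)%N -> card (T n.+1) = (t * card (T n))%N &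
  forall n x, (N <= n)%N -> T n.+1 x -> T n.+1 (phi x) -> T n x].
Proof.
have fT n : finite_set (T n) by exact: finite_trajectory.
have T_gt0 n : (0 < card (T n))%N.
  by apply: card_gt0 (trajectory1 phi n sF.1).
have TP n : T n `<=` P n.
  move=> x Tx; split; first exact: trajectory_leS sF.1 _ Tx.
  exact: (iter_trajectory 1 sF.1 Tx).
have fP n : finite_set (P n) by exact: finite_setIl.
have index_le n : (index n.+1 <= index n)%N.
  rewrite -(leq_pmul2r (T_gt0 n)) -cardTS cardTS_preimage leq_mul2l.
  by rewrite (card_subset (fP n) (TP n)) orbT.
have [N eqN] := nonincreasing_nat_stable index_le.
have index_gt0 : (0 < index N)%N.
  by have := T_gt0 N.+1; rewrite cardTS muln_gt0 => /andP[].
exists N, (index N); split=> // [n Nn|n x Nn Tx Tphix].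
  by rewrite cardTS eqN.
suff -> : T n = P n by [].
apply: card_subset_eq => //; apply/eqP; rewrite -(eqn_pmul2l index_gt0).
by rewrite -{1}(eqN n)// -cardTS cardTS_preimage eqN// (leq_trans Nn).
Qed.

End Stabilization.

(** * The part of a trajectory in an invariant kernel *)

Section KernelTrajectory.
Variables (G Q : groupType) (p : UMagmaMorphism.type G Q).
Variables (phi : UMagmaMorphism.type G G) (psi : UMagmaMorphism.type Q Q).
Hypothesis pphi : forall x, p (phi x) = psi (p x).
Hypotheses (pG : permutable G) (pQ : permutable Q).

Lemma iter_equivariant n x : p (iter n phi x) = iter n psi (p x).
Proof. by elim: n => //= n <-. Qed.

(** Let [N] be the rank from which the trajectory of [p F] is stable.  For [n]
    above [N], an element of [T_(n+1)(F)] in the kernel is [u phi^n(f)] with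
    [u] in [T_n(F)] and [f] in [F], so [psi^n (p f)] lies in [T_n(p F)].
    Stability brings this down to [psi^N (p f)] in [T_N(p F)], that is,
    [phi^N f = v h] with [v] in [T_N(F)] and [h] in the kernel.  Then
    [phi^n f = phi^(n-N) v phi^(n-N) h]: the first factor is absorbed by
    [T_n(F)], and the second belongs to the trajectory of
    [L = T_(N+1)(F) `&` ker p]. *)
Lemma trajectory_kernel F : finite_set F -> is_subgroup F ->
  exists L, [/\ finite_set L, is_subgroup L, L `<=` [set x | p x = 1] &
    forall n, trajectory phi F n `&` [set x | p x = 1] `<=` trajectory phi L n].
Proof.
move=> fF sF.
have sN : is_subgroup [set x | p x = 1].
  split=> [|x y] /=; first exact: gmulf1.
  by rewrite gmulfM gmulfV => -> ->; rewrite mulVg.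
have [N [t [_ _ stable]]] := trajectory_stable psi pQ
  (finite_image p fF) (is_subgroup_image p sF).
have sT n := is_subgroup_trajectory phi pG n sF.
have descend f k : F f -> trajectory psi (p @` F) (N + k) (iter (N + k) psi (p f)) ->
    trajectory psi (p @` F) N (iter N psi (p f)).
  move=> Ff; elim: k => [|k IH]; first by rewrite addn0.
  rewrite addnS => Tk; apply: IH; apply: stable; [exact: leq_addr| |exact: Tk].
  have pF1 := (is_subgroup_image p sF).1.
  rewrite -addn1; apply: iter_trajectory => //.
  by apply: trajectory_ge => //; exists f.
set L := trajectory phi F N.+1 `&` [set x | p x = 1].
have sL : is_subgroup L by exact: is_subgroupI.
have main m : trajectory phi F (N + m.+1) `&` [set x | p x = 1]
    `<=` trajectory phi L m.+1.
  elim: m => [|m IH].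
    by rewrite addn1; apply: trajectory_ge; exact: sL.1.
  (* The index of the general argument is [n = N + m + 1], so [n - N] is [m + 1]. *)
  move=> x []; rewrite {1}addnS trajectorySr.
  set n := (N + m.+1)%N => -[u Tu [_ [f Ff <-] <-]] /= pux.
  have [v Tv pv] : (p @` trajectory phi F N) (iter N psi (p f)).
    rewrite (trajectory_image _ _ pphi); apply: (descend _ m.+1 Ff).
    rewrite -(trajectory_image _ _ pphi) -iter_equivariant.
    exists u^-1; first exact: is_subgroupV.
    by apply: (mulgI (p u)); rewrite -!gmulfM pux mulgV gmulf1.
  pose h := v^-1 * iter N phi f.
  have Lh : L h.
    split; last by rewrite /= gmulfM gmulfV pv iter_equivariant mulVg.
    apply: (sT _).2; first exact: trajectory_leS sF.1 _ Tv.
    rewrite -addn1; apply: iter_trajectory sF.1 _.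
    by apply: trajectory_ge => //; exact: sF.1.
  have fE : iter n phi f = iter m.+1 phi v * iter m.+1 phi h.
    by rewrite -iter_morphM mulVKg /n addnC iterD.
  have hn1 : p (iter m.+1 phi h) = 1 by rewrite iter_equivariant Lh.2 iter_morph1.
  rewrite trajectorySr fE mulgA.
  exists (u * iter m.+1 phi v); last by exists (iter m.+1 phi h) => //; exists h.
  apply: IH; split; last first.
    by rewrite /= -pux fE !gmulfM hn1 mulg1.
  apply: is_subgroupM => //.
  by rewrite /n addnC; apply: iter_trajectory sF.1 _.
exists L; split=> //.
- by apply: finite_setIl; exact: finite_trajectory.
- by move=> x [].
case=> [|n] x [Tx px].
  by move: Tx; rewrite !trajectory0.
apply: main; split=> //; apply: trajectory_le sF.1 _ _ Tx.
by rewrite leq_addl.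
Qed.

End KernelTrajectory.

(** * Exponential growth rates *)

Section ExponentialGrowth.
Variable R : realType.
Local Open Scope ring_scope.
Implicit Types (u v w : nat -> nat) (l m k : R).

Definition growth u l := (fun n => ln ((u n)%:R : R) / n%:R) @ \oo --> l.

Lemma ln_nat_le (a b : nat) : (0 < a)%N -> (a <= b)%N ->
  ln (a%:R : R) <= ln b%:R.
Proof.
move=> a0 ab; rewrite ler_ln ?posrE ?ltr0n ?ler_nat //.
exact: leq_trans ab.
Qed.

Lemma ln_nat_mul (a b : nat) : (0 < a)%N -> (0 < b)%N ->
  ln ((a * b)%N%:R : R) = ln a%:R + ln b%:R.
Proof. by move=> a0 b0; rewrite natrM lnM ?posrE ?ltr0n. Qed.

Lemma growth_superadd u v w l m k : growth u l -> growth v m -> growth w k ->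
  (forall n, 0 < u n)%N -> (forall n, 0 < v n)%N ->
  (forall n, u n * v n <= w n)%N -> l + m <= k.
Proof.
move=> ul vm wk u0 v0 uvw; apply: ler_cvg_to (cvgD ul vm) wk _.
apply: nearW => n; rewrite fctE -mulrDl ler_wpM2r ?invr_ge0 ?ler0n //.
by rewrite -ln_nat_mul// ln_nat_le// muln_gt0 u0 v0.
Qed.

Lemma growth_subadd u v w l m k : growth u l -> growth v m -> growth w k ->
  (forall n, 0 < u n)%N -> (forall n, 0 < v n)%N -> (forall n, 0 < w n)%N ->
  (forall n, w n <= u n * v n)%N -> k <= l + m.
Proof.
move=> ul vm wk u0 v0 w0 wuv; apply: ler_cvg_to wk (cvgD ul vm) _.
apply: nearW => n; rewrite fctE -mulrDl ler_wpM2r ?invr_ge0 ?ler0n //.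
by rewrite -ln_nat_mul// ln_nat_le.
Qed.

Lemma growth_geometric u N t : (0 < t)%N -> (forall n, 0 < u n)%N ->
  (forall n, N <= n -> u n.+1 = t * u n)%N -> growth u (ln t%:R).
Proof.
move=> t0 u0 ut.
have [c uE] : exists c : R, forall j,
    ln ((u (N + j)%N)%:R : R) = c + (N + j)%N%:R * ln t%:R.
  exists (ln (u N)%:R - N%:R * ln t%:R).
  elim=> [|j IH]; first by rewrite addn0 subrK.
  rewrite addnS ut ?leq_addr// ln_nat_mul// IH.
  by rewrite -natr1 mulrDl mul1r addrCA [X in _ + X = _]addrC.
rewrite /growth -[ln t%:R]add0r -(mulr0 c).
suff : (fun n => c * n%:R^-1 + ln t%:R) @ \oo --> c * 0 + (ln t%:R : R).
  (* Starting at [N.+1] keeps the denominator [n] nonzero when [N] is 0. *)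
  apply: cvg_trans; apply: near_eq_cvg; exists N.+1 => // n /= Nn.
  rewrite -(subnKC (ltnW Nn)) uE mulrDl mulrAC divff ?mul1r//.
  by rewrite pnatr_eq0 subnKC ?(ltnW Nn)// -lt0n (leq_trans _ Nn).
apply: cvgD; last exact: cvg_cst.
by apply: cvgMr; rewrite -cvg_shiftS; exact: cvg_harmonic.
Qed.

End ExponentialGrowth.

(** * Entropy computed on finite subgroups *)

Section Entropy.
Variables (R : realType) (G : groupType) (phi : UMagmaMorphism.type G G).
Local Open Scope ereal_scope.

Lemma H_alg_mono (U V : set G) : U 1%g -> finite_set V -> U `<=` V ->
  H_alg R phi U <= H_alg R phi V.
Proof.
move=> U1 fV UV; rewrite /H_alg !limn_esup_lim.
apply: lee_lim; [exact: is_cvg_esups|exact: is_cvg_esups|].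
apply: nearW => n; apply: ge_ereal_sup => _ [j nj <-].
apply: (@le_trans _ _ (ln (#|` fset_set (trajectory phi V j)|%:R : R) / j%:R)%:E).
  rewrite lee_fin ler_wpM2r ?invr_ge0 ?ler0n// ln_nat_le//.
    by apply: card_gt0 (trajectory1 phi j U1); apply: finite_trajectory;
      exact: sub_finite_set fV.
  by apply: card_subset; [exact: finite_trajectory|exact: trajectory_mono].
by apply: ereal_sup_ubound; exists j.
Qed.

Lemma H_alg_le_h_alg (F : set G) : finite_set F -> is_subgroup F ->
  H_alg R phi F <= h_alg R phi.
Proof.
by move=> fF sF; apply: ereal_sup_ubound; exists F => //; split=> //; exact: sF.1.
Qed.

Hypotheses (pG : permutable G) (tG : torsion G).

(** For a finite subgroup the upper limit defining the entropy is a limit: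
    from some rank on, the trajectory grows by a constant factor. *)
Lemma H_alg_growth (F : set G) : finite_set F -> is_subgroup F ->
  exists l : R, [/\ (0 <= l)%R,
    growth (fun n => card (trajectory phi F n)) l & H_alg R phi F = l%:E].
Proof.
move=> fF sF; have [N [t [t0 cardT _]]] := trajectory_stable phi pG fF sF.
have gr : growth (fun n => card (trajectory phi F n)) (ln t%:R : R).
  apply: growth_geometric cardT => // n.
  by apply: card_gt0 (trajectory1 phi n sF.1); exact: finite_trajectory.
exists (ln t%:R); split=> //; first by rewrite ln_ge0// ler1n.
apply: (cvg_limn_einf_sup _).2.
by apply: cvg_EFin; [exact: nearW|exact: gr].
Qed.

Lemma h_alg_le c :
  (forall F, finite_set F -> is_subgroup F -> H_alg R phi F <= c) ->
  h_alg R phi <= c.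
Proof.
move=> le_c; apply: ge_ereal_sup => _ [U [fU U1] <-].
have [F [fF sF UF]] := locally_finite pG tG fU.
exact: le_trans (H_alg_mono U1 fF UF) (le_c F fF sF).
Qed.

End Entropy.

(** * The addition formula for an exact sequence *)

Section AdditionTheorem.
Variables (R : realType) (S G Q : groupType).
Variables (i : UMagmaMorphism.type S G) (p : UMagmaMorphism.type G Q).
Variables (chi : UMagmaMorphism.type S S) (phi : UMagmaMorphism.type G G)
  (psi : UMagmaMorphism.type Q Q).
Hypotheses (iphi : forall x, i (chi x) = phi (i x))
  (pphi : forall x, p (phi x) = psi (p x)).
Hypotheses (inj_i : injective i) (surj_p : forall y, exists x, p x = y)
  (exact_ip : range i = [set x | p x = 1]).
Hypotheses (pG : permutable G) (tG : torsion G).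

Let pS : permutable S := permutable_injective inj_i pG.
Let tS : torsion S := torsion_injective inj_i tG.
Let pQ : permutable Q := permutable_surjective surj_p pG.
Let tQ : torsion Q := torsion_surjective surj_p tG.

Lemma card_trajectory_extension F n : finite_set F -> is_subgroup F ->
  card (trajectory phi F n) = (card (trajectory psi (p @` F) n) *
    card (trajectory phi F n `&` range i))%N.
Proof.
move=> fF sF; rewrite -(trajectory_image _ _ pphi).
apply: card_fibers; [exact: finite_trajectory|exact: is_subgroup_trajectory|].
move=> x y _ _; rewrite exact_ip /= gmulfM gmulfV.
split=> [->|E]; first by rewrite mulVg.
by apply: (mulgI (p x)^-1); rewrite E mulVg.
Qed.

Let card_gt0_trajectory (K : groupType) (f : UMagmaMorphism.type K K) F n :
  finite_set F -> is_subgroup F -> (0 < card (trajectory f F n))%N.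
Proof.
move=> fF sF; apply: card_gt0 (trajectory1 f n sF.1); exact: finite_trajectory.
Qed.

(** The trajectory of [F] meets [S] inside the trajectory of the subgroup [L]
    of [trajectory_kernel], so [L] accounts for the second factor of
    [card_trajectory_extension]. *)
Lemma h_alg_le_extension :
  (h_alg R phi <= h_alg R psi + h_alg R chi)%E.
Proof.
apply: h_alg_le => // F fF sF.
have [L [fL sL Lker TL]] := trajectory_kernel pphi pG pQ fF sF.
have fpF := finite_image p fF; have spF := is_subgroup_image p sF.
have LE : i @` (i @^-1` L) = L.
  apply/seteqP; split=> [_ [s Ls <-] //|x Lx].
  have [s _ sx] : range i x by rewrite exact_ip; exact: Lker.
  by exists s => //=; rewrite sx.
have fiL : finite_set (i @^-1` L) by apply: finite_preimage => // x y _ _ /inj_i.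
have siL := is_subgroup_preimage i sL.
have [k [_ gk kE]] := H_alg_growth R phi pG fF sF.
have [l [_ gl lE]] := H_alg_growth R psi pQ fpF spF.
have [m [_ gm mE]] := H_alg_growth R chi pS fiL siL.
apply: le_trans (leeD (H_alg_le_h_alg R psi fpF spF)
  (H_alg_le_h_alg R chi fiL siL)).
rewrite kE lE mE -EFinD lee_fin.
apply: (growth_subadd gl gm gk) => n; try exact: card_gt0_trajectory.
rewrite card_trajectory_extension// leq_mul2l; apply/orP; right.
rewrite -(card_injective_image inj_i); last exact: finite_trajectory.
rewrite (trajectory_image _ _ iphi) LE exact_ip.
by apply: card_subset => //; exact: finite_trajectory.
Qed.

(** A finite subgroup [K] of [G] that contains [F] and a lift of [E] has a
    trajectory that projects onto at least that of [E], and meets [S] in at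
    least that of [F]. *)
Lemma H_alg_add_le_h_alg (E : set Q) (F : set S) :
  finite_set E -> is_subgroup E -> finite_set F -> is_subgroup F ->
  (H_alg R psi E + H_alg R chi F <= h_alg R phi)%E.
Proof.
move=> fE sE fF sF.
have [r rK] := choice surj_p.
have [|K [fK sK rEK]] := locally_finite (U := r @` E `|` i @` F) pG tG.
  by rewrite finite_setU; split; exact: finite_image.
have EK : E `<=` p @` K.
  by move=> y Ey; exists (r y); rewrite ?rK//; apply: rEK; left; exists y.
have FK : i @` F `<=` K by move=> x Fx; apply: rEK; right.
have [k [_ gk kE]] := H_alg_growth R phi pG fK sK.
have [l [_ gl lE]] := H_alg_growth R psi pQ fE sE.
have [m [_ gm mE]] := H_alg_growth R chi pS fF sF.
apply: le_trans (H_alg_le_h_alg R phi fK sK).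
rewrite kE lE mE -EFinD lee_fin.
apply: (growth_superadd gl gm gk) => n; try exact: card_gt0_trajectory.
rewrite card_trajectory_extension// leq_mul//.
  apply: card_subset; last exact: trajectory_mono.
  by apply: finite_trajectory; exact: finite_image.
rewrite -(card_injective_image inj_i); last exact: finite_trajectory.
apply: card_subset; first by apply: finite_setIl; exact: finite_trajectory.
move=> _ [s Ts <-]; split; last by exists s.
apply: trajectory_mono FK _ _; rewrite -(trajectory_image _ _ iphi).
by exists s.
Qed.

(** The upper bounds [H_alg R psi E + H_alg R chi F <= h_alg R phi] pass to the
    two suprema one after the other.  Subtracting a term from the bound
    requires it to be finite, hence the case [h_alg R phi = +oo] is set
    apart. *)
Theorem h_alg_extension : (h_alg R phi = h_alg R psi + h_alg R chi)%E.
Proof.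
apply/eqP; rewrite eq_le h_alg_le_extension andTb.
have s1 (K : groupType) : is_subgroup [set 1 : K].
  by split=> // x y -> ->; rewrite mulVg.
have h_ge0 (K : groupType) (f : UMagmaMorphism.type K K) :
    permutable K -> (0 <= h_alg R f)%E.
  move=> pK; have [l [l0 _ lE]] := H_alg_growth R f pK (finite_set1 1) (s1 K).
  apply: le_trans (H_alg_le_h_alg R f (finite_set1 1) (s1 K)).
  by rewrite lE lee_fin.
have [->|phi_fin] := eqVneq (h_alg R phi) +oo%E; first exact: leey.
have {}phi_fin : h_alg R phi \is a fin_num by rewrite ge0_fin_numE ?h_ge0 ?ltey.
have chi_le E : finite_set E -> is_subgroup E ->
    (h_alg R chi <= h_alg R phi - H_alg R psi E)%E.
  move=> fE sE; apply: h_alg_le => // F fF sF.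
  rewrite lee_suber_addl//; exact: H_alg_add_le_h_alg.
have chi_fin : h_alg R chi \is a fin_num.
  rewrite ge0_fin_numE ?h_ge0//.
  apply: le_lt_trans (chi_le [set 1] (finite_set1 1) (s1 Q)) _.
  have [l [_ _ ->]] := H_alg_growth R psi pQ (finite_set1 1) (s1 Q).
  by rewrite ltey -(fineK phi_fin).
rewrite -lee_suber_addr//; apply: h_alg_le => // E fE sE.
by rewrite lee_suber_addr// -lee_suber_addl//; exact: chi_le.
Qed.

End AdditionTheorem.

(** * The exact sequence of a normal subgroup *)

Section QuotientMap.
Local Open Scope quotient_scope.
Variables (G : groupType) (H : groupClosed G) (nH : normal_subgroup H).

Definition quot_map (x : G) : quotient_group nH := \pi_(quotient_group nH) x.

Lemma quot_map_morph : monoid.monoid_morphism quot_map.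
Proof. by split=> // x y; apply/esym/quot_mulE. Qed.

HB.instance Definition _ :=
  isUMagmaMorphism.Build G (quotient_group nH) quot_map quot_map_morph.

Lemma quot_map_surj y : exists x, quot_map x = y.
Proof. by exists (repr y); exact: reprK. Qed.

Lemma quot_map_ker : [set x | quot_map x = 1] = [set` H].
Proof.
apply/seteqP; split=> x /=.
  by move/esym/(Defs.quotP nH 1 x); rewrite invg1 mul1g.
by move=> Hx; apply/esym/(Defs.quotP nH 1 x); rewrite invg1 mul1g.
Qed.

Definition subgroup_incl (x : subgroup_type H) : G := val x.

Lemma subgroup_incl_morph : monoid.monoid_morphism subgroup_incl.
Proof. by split=> [|x y]; [exact: val1|exact: valM]. Qed.

HB.instance Definition _ :=
  isUMagmaMorphism.Build (subgroup_type H) G subgroup_incl subgroup_incl_morph.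

Lemma range_subgroup_incl : range subgroup_incl = [set` H].
Proof.
apply/seteqP; split=> [_ [x _ <-]|x Hx]; first exact: valP.
by exists (exist _ x Hx).
Qed.

End QuotientMap.

Theorem theorem5p9 (R : realType) (G : groupType)
    (hQ : quasihamiltonian G) (hT : torsion G) (hFC : FC_group G)
    (phi : UMagmaMorphism.type G G) (H : groupClosed G)
    (nH : normal_subgroup H) (sH : stable_subgroup phi H) :
  (h_alg R phi = h_alg R (quot_endo nH sH) + h_alg R (restr_endo sH))%E.
Proof.
apply: (@h_alg_extension R _ _ _ (subgroup_incl (H := H)) (quot_map nH)) => //.
- by move=> x; rewrite [RHS]quot_endoE.
- exact: quot_map_surj.
- by rewrite range_subgroup_incl quot_map_ker.
- exact: quasihamiltonian_permutable.
Qed.
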